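(* Let $f\colon\mathbb{R}^n\to\mathbb{R}\cup\{+\infty\}$ be convex, $A_1\in\mathbb{R}^{m_1\times n}$, $A_2\in\mathbb{R}^{m_2\times n}$, $b_1\in\mathbb{R}^{m_1}$, $b_2\in\mathbb{R}^{m_2}$. Suppose that: (1) $\operatorname{argmin}_{x\in\operatorname{dom} f}\frac12\|b_1-A_1x\|^2\neq\emptyset$ and $\operatorname{argmin}_{x\in\mathcal{X}_1}\frac12\|b_2-A_2x\|^2\neq\emptyset$, so that the hierarchically optimal shift $(s_1^\ast,s_2^\ast)$ is defined; (2) the set $A(\operatorname{dom} f)=\{Ax\in\mathbb{R}^{m_1+m_2}\colon x\in\operatorname{dom} f\}$ is closed, where $A=\begin{bmatrix} A_1 \\ A_2 \end{bmatrix}$; (3) $\{\sigma_1^{(k)}\}_{k\ge0}$ and $\{\sigma_2^{(k)}\}_{k\ge0}$ are sequences of positive reals with $\lim_{k\to\infty}\sigma_1^{(k)}/\sigma_2^{(k)}=\infty$ and $\sigma_1^{(k-1)}/\sigma_2^{(k-1)}\le\sigma_1^{(k)}/\sigma_2^{(k)}$ for all $k\ge1$. Write $\sigma^{(k)}=(\sigma_1^{(k)},\sigma_2^{(k)})$. Then the approximate hierarchically optimal shifts satisfy $$\lim_{k\to\infty}\bar s_1(\sigma^{(k)})=s_1^\ast,\qquad \lim_{k\to\infty}\bar s_2(\sigma^{(k)})=s_2^\ast.$$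
   Context: $\|\cdot\|$ is the Euclidean norm and $\operatorname{dom} f=\{x\colon f(x)<+\infty\}$. Hierarchically optimal shift: $s_1^\ast:=b_1-A_1x^\dagger$ with $x^\dagger\in\operatorname{argmin}_{x\in\operatorname{dom} f}\frac12\|b_1-A_1x\|^2$; $\mathcal{X}_1:=\{x\in\operatorname{dom} f\colon s_1^\ast=b_1-A_1x\}$; $s_2^\ast:=b_2-A_2x^\ddagger$ with $x^\ddagger\in\operatorname{argmin}_{x\in\mathcal{X}_1}\frac12\|b_2-A_2x\|^2$. Approximate hierarchically optimal shift: for $\sigma=(\sigma_1,\sigma_2)$ with $\sigma_1,\sigma_2>0$, $(\bar x(\sigma),\bar s_1(\sigma),\bar s_2(\sigma))$ denotes an optimal solution of the infeasibility control problem: minimize $\frac{\sigma_1}{2}\|s_1\|^2+\frac{\sigma_2}{2}\|s_2\|^2$ over $(x,s_1,s_2)\in\mathbb{R}^n\times\mathbb{R}^{m_1}\times\mathbb{R}^{m_2}$ subject to $s_1=b_1-A_1x$, $s_2=b_2-A_2x$, $x\in\operatorname{dom} f$. (Under (2) and $\operatorname{dom} f\ne\emptyset$ such a solution exists, and its component $(\bar s_1(\sigma),\bar s_2(\sigma))$ is unique.) *)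

(* Defs.v *)
From HB Require Import structures.
From mathcomp Require Import all_boot all_order all_algebra.
From mathcomp Require Import all_classical all_reals all_analysis.
Set Implicit Arguments.
Unset Strict Implicit.
Unset Printing Implicit Defensive.
Import Order.TTheory GRing.Theory Num.Theory.
Import numFieldNormedType.Exports.
Local Open Scope classical_set_scope.
Local Open Scope ring_scope.

(* The library norm on matrices is the sup norm; it induces the same topology. *)
Definition enorm (R : realType) (m : nat) (v : 'cV[R]_m) : R :=
  Num.sqrt (\sum_(i < m) v i ord0 ^+ 2).

Definition edom (R : realType) (T : Type) (f : T -> \bar R) : set T :=
  [set x | (f x < +oo)%E].

(* Meant for f with values in R U {+oo}, for which the sum on the right is never
   of the form oo - oo; the endpoints of [0, 1] are harmless since 0 * +oo = 0. *)
Definition econvex (R : realType) (n : nat) (f : 'cV[R]_n -> \bar R) : Prop :=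
  forall (x y : 'cV[R]_n) (t : R), 0 <= t <= 1 ->
    (f (t *: x + (1 - t) *: y)%R <= t%:E * f x + (1 - t)%:E * f y)%E.

Definition argmin (R : realType) (T : Type) (D : set T) (g : T -> R) : set T :=
  [set x | D x /\ forall y, D y -> g x <= g y].

Definition half_sq_residual (R : realType) (m n : nat)
    (A : 'M[R]_(m, n)) (b : 'cV[R]_m) (x : 'cV[R]_n) : R :=
  1 / 2 * enorm (b - A *m x) ^+ 2.

Definition first_level_set (R : realType) (m n : nat) (f : 'cV[R]_n -> \bar R)
    (A : 'M[R]_(m, n)) (b s : 'cV[R]_m) : set 'cV[R]_n :=
  [set x | edom f x /\ s = b - A *m x].

(* A pair (s1, s2) with this property exists exactly when the two argmin sets
   are nonempty. *)
Definition hier_opt_shift (R : realType) (n m1 m2 : nat)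
    (f : 'cV[R]_n -> \bar R) (A1 : 'M[R]_(m1, n)) (A2 : 'M[R]_(m2, n))
    (b1 : 'cV[R]_m1) (b2 : 'cV[R]_m2) (s1 : 'cV[R]_m1) (s2 : 'cV[R]_m2) : Prop :=
  (exists2 x, argmin (edom f) (half_sq_residual A1 b1) x & s1 = b1 - A1 *m x) /\
  (exists2 x, argmin (first_level_set f A1 b1 s1) (half_sq_residual A2 b2) x
            & s2 = b2 - A2 *m x).

Definition icp_feasible (R : realType) (n m1 m2 : nat)
    (f : 'cV[R]_n -> \bar R) (A1 : 'M[R]_(m1, n)) (A2 : 'M[R]_(m2, n))
    (b1 : 'cV[R]_m1) (b2 : 'cV[R]_m2) : set ('cV[R]_n * 'cV[R]_m1 * 'cV[R]_m2) :=
  [set p | let: (x, s1, s2) := p in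
    [/\ s1 = b1 - A1 *m x, s2 = b2 - A2 *m x & edom f x]].

Definition icp_objective (R : realType) (n m1 m2 : nat) (sigma1 sigma2 : R)
    (p : 'cV[R]_n * 'cV[R]_m1 * 'cV[R]_m2) : R :=
  let: (_, s1, s2) := p in
  sigma1 / 2 * enorm s1 ^+ 2 + sigma2 / 2 * enorm s2 ^+ 2.

(* Optimal solutions of the infeasibility control problem. *)
Definition icp_solutions (R : realType) (n m1 m2 : nat)
    (f : 'cV[R]_n -> \bar R) (A1 : 'M[R]_(m1, n)) (A2 : 'M[R]_(m2, n))
    (b1 : 'cV[R]_m1) (b2 : 'cV[R]_m2) (sigma1 sigma2 : R) :
    set ('cV[R]_n * 'cV[R]_m1 * 'cV[R]_m2) :=
  argmin (icp_feasible f A1 A2 b1 b2) (icp_objective sigma1 sigma2).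

(* Main.v *)
Require Import Defs.
From HB Require Import structures.
From mathcomp Require Import all_boot all_order all_algebra.
From mathcomp Require Import all_classical all_reals all_analysis.
From mathcomp Require Import ring lra.
Set Implicit Arguments.
Unset Strict Implicit.
Unset Printing Implicit Defensive.
Import Order.TTheory GRing.Theory Num.Theory.
Import numFieldNormedType.Exports.
Local Open Scope classical_set_scope.
Local Open Scope ring_scope.

(** Comparing a minimizer with midpoints of segments of [dom f] and using the
    parallelogram identity, the squared distance from the minimizing residual
    to any other one is at most twice the excess of the objective.  With
    [r = sigma1 / sigma2], testing against the hierarchical solution gives
    [|s2bar| <= |s2|] and [|s1bar - s1|^2 <= 2 |s2|^2 / r -> 0].  As [r] grows,
    the inequality makes [|s2bar|^2] nondecreasing, hence convergent, and
    controls the increments of [s2bar] by those of [|s2bar|^2]: [s2bar] is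
    Cauchy, so no compactness is needed.  Its limit [p] satisfies
    [|p| <= |s2|], and [(s1, p)] is an attained residual because [A (dom f)] is
    closed; the second-level minimality of [s2] then forces [p = s2]. *)

Lemma enorm_sqE (R : realType) (m : nat) (v : 'cV[R]_m) :
  enorm v ^+ 2 = \sum_(i < m) v i ord0 ^+ 2.
Proof. by rewrite sqr_sqrtr// sumr_ge0// => i _; rewrite sqr_ge0. Qed.

Lemma enorm_sq_ge_entry (R : realType) (m : nat) (v : 'cV[R]_m) i j :
  v i j ^+ 2 <= enorm v ^+ 2.
Proof.
rewrite enorm_sqE (ord1 j) (bigD1 i)//= lerDl sumr_ge0// => k _.
exact: sqr_ge0.
Qed.

Lemma enorm_sq_le0_eq (R : realType) (m : nat) (u v : 'cV[R]_m) :
  enorm (u - v) ^+ 2 <= 0 -> u = v.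
Proof.
move=> uv0; apply/matrixP => i j; apply/eqP; rewrite -subr_eq0 -sqrf_eq0.
rewrite eq_le sqr_ge0 andbT; apply: le_trans uv0.
by have := enorm_sq_ge_entry (u - v) i j; rewrite !mxE.
Qed.

(** The residual is affine in the point, so the midpoint has the averaged residual and the
    parallelogram identity applies. *)
Lemma residual_midpoint (R : realType) (m n : nat) (A : 'M[R]_(m, n))
    (b : 'cV[R]_m) (x y : 'cV[R]_n) :
  enorm (b - A *m (2^-1 *: (x + y))) ^+ 2 =
  2^-1 * enorm (b - A *m x) ^+ 2 + 2^-1 * enorm (b - A *m y) ^+ 2
  - 4^-1 * enorm ((b - A *m y) - (b - A *m x)) ^+ 2.
Proof.
rewrite -scalemxAr mulmxDr !enorm_sqE !mulr_sumr -sumrN -!big_split /=.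
by apply: eq_bigr => i _; rewrite !mxE; field.
Qed.

(** Convexity of [f] enters the argument only here: it makes midpoints admissible competitors. *)
Lemma edom_midpoint (R : realType) (n : nat) (f : 'cV[R]_n -> \bar R) x y :
  econvex f -> edom f x -> edom f y -> edom f (2^-1 *: (x + y)).
Proof.
rewrite /edom /= => /(_ x y 2^-1) + fx fy.
have -> : 1 - 2^-1 = 2^-1 :> R by field.
rewrite -scalerDr => fc; apply: le_lt_trans (fc _) _; first by lra.
by rewrite lte_add_pinfty// lte_mul_pinfty// lee_fin; lra.
Qed.

Lemma cvg_mx_entry (R : realType) (m n : nat) (u : nat -> 'M[R]_(m, n))
    (l : 'M[R]_(m, n)) :
  (forall i j, (fun k => u k i j) @ \oo --> l i j) -> u @ \oo --> l.
Proof.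
move=> ul A [P lP PA]; apply: filterS (_ : \forall k \near \oo, _).
  by move=> k; exact: (PA (u k)).
by apply: filter_forall => i; apply: filter_forall => j; exact: ul.
Qed.

Lemma cvg_entry (R : realType) (m n : nat) (u : nat -> 'M[R]_(m, n))
    (l : 'M[R]_(m, n)) i j :
  u @ \oo --> l -> (fun k => u k i j) @ \oo --> l i j.
Proof.
move=> ul; have c := @coord_continuous R m n i j l.
exact: (cvg_comp _ _ ul c).
Qed.

(** Passes from Euclidean estimates to the entrywise topology: each entry is dominated by
    [enorm]. *)
Lemma cvg_enorm_sq (R : realType) (m : nat) (u : nat -> 'cV[R]_m)
    (l : 'cV[R]_m) :
  (fun k => enorm (u k - l) ^+ 2) @ \oo --> 0 -> u @ \oo --> l.
Proof.
move=> ul; apply: cvg_mx_entry => i j; apply/cvgrPdist_lt => e e0.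
move/cvgrPdist_lt : ul => /(_ (e ^+ 2)); rewrite exprn_gt0// => /(_ isT).
apply: filterS => k; rewrite sub0r normrN ger0_norm ?sqr_ge0// => ule.
rewrite -(ltr_pXn2r (n := 2)) ?nnegrE ?normr_ge0 ?ltW//.
  rewrite real_normK ?num_real//.
apply: le_lt_trans ule; have := enorm_sq_ge_entry (u k - l) i j.
by rewrite !mxE -[in X in X -> _]sqrrN opprB.
Qed.

Lemma enorm_sq_cvg (R : realType) (m : nat) (u : nat -> 'cV[R]_m)
    (l : 'cV[R]_m) :
  u @ \oo --> l -> (fun k => enorm (u k) ^+ 2) @ \oo --> enorm l ^+ 2.
Proof.
move=> ul; rewrite enorm_sqE; under eq_fun do rewrite enorm_sqE.
apply: cvg_big => [|i _]; first exact: add_continuous.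
apply: (@cvgM _ _ \oo _ (fun k => u k i ord0) (fun k => u k i ord0));
  exact: cvg_entry.
Qed.

Lemma is_cvg_enorm_sq_gap (R : realType) (m : nat) (u : nat -> 'cV[R]_m)
    (a : nat -> R) :
  cvgn a -> (forall k l, (k <= l)%N ->
    enorm (u l - u k) ^+ 2 <= 2 * (a l - a k)) -> cvgn u.
Proof.
move=> /cvg_ex[/= c /cvgrPdist_lt ac] ua; apply/cauchy_cvgP/cauchy_exP => e e0.
(* Two terms of [a] within [e ^+ 2 / 4] of [c] differ by less than [e ^+ 2 / 2], and the hypothesis
   doubles this. *)
have e2 : 0 < e ^+ 2 / 4 by rewrite divr_gt0// exprn_gt0.
have [N _ acN] := ac _ e2.
exists (u N); exists N => // k /= Nk; split => // i j.
rewrite /ball /= distrC -(ltr_pXn2r (n := 2)) ?nnegrE ?normr_ge0 ?ltW//.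
  rewrite real_normK ?num_real//.
have := enorm_sq_ge_entry (u k - u N) i j; rewrite !mxE => uk.
have := acN _ (leqnn N); have := acN _ Nk; have := ua _ _ Nk.
by rewrite /= !ltr_distl => ? /andP[? ?] /andP[? ?]; lra.
Qed.

Lemma cvg_col_mx (R : realType) (m1 m2 n : nat) (u : nat -> 'M[R]_(m1, n))
    (v : nat -> 'M[R]_(m2, n))
    (p : 'M[R]_(m1, n)) (q : 'M[R]_(m2, n)) :
  u @ \oo --> p -> v @ \oo --> q ->
  (fun k => col_mx (u k) (v k)) @ \oo --> col_mx p q.
Proof.
move=> up vq; apply: cvg_mx_entry => i j; rewrite mxE.
under eq_fun do rewrite mxE.
case: (fintype.split i) => a; exact: cvg_entry.
Qed.

Theorem theorem1 (R : realType) (n m1 m2 : nat)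
    (f : 'cV[R]_n -> \bar R)
    (f_ninfty : forall x, f x <> -oo%E) (f_convex : econvex f)
    (A1 : 'M[R]_(m1, n)) (A2 : 'M[R]_(m2, n))
    (b1 : 'cV[R]_m1) (b2 : 'cV[R]_m2)
    (s1 : 'cV[R]_m1) (s2 : 'cV[R]_m2)
    (argmin1_nonempty : argmin (edom f) (half_sq_residual A1 b1) !=set0)
    (argmin2_nonempty :
      argmin (first_level_set f A1 b1 s1) (half_sq_residual A2 b2) !=set0)
    (s_opt : hier_opt_shift f A1 A2 b1 b2 s1 s2)
    (A_dom_closed :
      closed ((fun x : 'cV[R]_n => col_mx A1 A2 *m x) @` edom f))
    (sigma1 sigma2 : nat -> R)
    (sigma1_gt0 : forall k, 0 < sigma1 k) (sigma2_gt0 : forall k, 0 < sigma2 k)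
    (sigma_ratio_cvg : (fun k => sigma1 k / sigma2 k) @ \oo --> +oo)
    (sigma_ratio_nondecr : forall k, (1 <= k)%N ->
      sigma1 k.-1 / sigma2 k.-1 <= sigma1 k / sigma2 k)
    (xbar : nat -> 'cV[R]_n) (s1bar : nat -> 'cV[R]_m1) (s2bar : nat -> 'cV[R]_m2)
    (sbar_opt : forall k,
      icp_solutions f A1 A2 b1 b2 (sigma1 k) (sigma2 k)
        (xbar k, s1bar k, s2bar k)) :
  s1bar @ \oo --> s1 /\ s2bar @ \oo --> s2.
Proof.
have [[x1 [Dx1 min1] s1E] [x0 [[Dx0 s1x0] min2] s2E]] := s_opt.
have half_le (c d : R) : 1 / 2 * c <= 1 / 2 * d -> c <= d by lra.
have {}min1 y : edom f y -> enorm s1 ^+ 2 <= enorm (b1 - A1 *m y) ^+ 2.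
  by move=> /min1; rewrite /half_sq_residual -s1E => /half_le.
have {}min2 y : edom f y -> s1 = b1 - A1 *m y ->
    enorm s2 ^+ 2 <= enorm (b2 - A2 *m y) ^+ 2.
  move=> Dy s1y; have /min2 : first_level_set f A1 b1 s1 y by [].
  by rewrite /half_sq_residual -s2E => /half_le.
have s1barE k : s1bar k = b1 - A1 *m xbar k by have [[]] := sbar_opt k.
have s2barE k : s2bar k = b2 - A2 *m xbar k by have [[]] := sbar_opt k.
have Dxbar k : edom f (xbar k) by have [[]] := sbar_opt k.
pose r k := sigma1 k / sigma2 k.
have r_gt0 k : 0 < r k by rewrite divr_gt0.
have r_ndecr : nondecreasing_seq r.
  by apply/nondecreasing_seqP => k; exact: (sigma_ratio_nondecr k.+1).
(* The objective divided by [sigma2 k / 2] depends on the weights only through [r k]. *)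
have opt k y : edom f y ->
    r k * enorm (s1bar k) ^+ 2 + enorm (s2bar k) ^+ 2 <=
    r k * enorm (b1 - A1 *m y) ^+ 2 + enorm (b2 - A2 *m y) ^+ 2.
  move=> Dy; have [_ /(_ (y, b1 - A1 *m y, b2 - A2 *m y))] := sbar_opt k.
  move=> /(_ (And3 erefl erefl Dy)) /= opt_y.
  have sE : sigma1 k = r k * sigma2 k by rewrite divfK ?gt_eqF.
  rewrite -(ler_pM2l (x := sigma2 k / 2)) ?divr_gt0// -subr_ge0.
  by move: opt_y; rewrite sE -subr_ge0; congr (0 <= _); field.
(* Four times the optimality inequality tested at the midpoint of [xbar k] and [y]. *)
have gap k y : edom f y ->
    r k * enorm ((b1 - A1 *m y) - s1bar k) ^+ 2 +
      enorm ((b2 - A2 *m y) - s2bar k) ^+ 2 <=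
    2 * (r k * (enorm (b1 - A1 *m y) ^+ 2 - enorm (s1bar k) ^+ 2) +
      (enorm (b2 - A2 *m y) ^+ 2 - enorm (s2bar k) ^+ 2)).
  move=> Dy; have := opt k _ (edom_midpoint f_convex (Dxbar k) Dy).
  rewrite (residual_midpoint A1 b1 (xbar k) y).
  rewrite (residual_midpoint A2 b2 (xbar k) y).
  rewrite -(s1barE k) -(s2barE k).
  move: (enorm (b1 - A1 *m y - s1bar k) ^+ 2) (enorm (b1 - A1 *m y) ^+ 2).
  move: (enorm (b2 - A2 *m y - s2bar k) ^+ 2) (enorm (b2 - A2 *m y) ^+ 2).
  move: (r k) (enorm (s1bar k) ^+ 2) (enorm (s2bar k) ^+ 2) => *.
  by lra.
have s2bar_le k : enorm (s2bar k) ^+ 2 <= enorm s2 ^+ 2.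
  have := opt k x0 Dx0; rewrite -s1x0 -s2E.
  have := min1 _ (Dxbar k); rewrite -s1barE -(ler_pM2l (r_gt0 k)).
  move: (r k) (enorm (s1bar k) ^+ 2) (enorm (s2bar k) ^+ 2) => *.
  by lra.
(* First-level minimality at the midpoint bounds the squared distance by twice the excess of
   [enorm (s1bar k) ^+ 2] over [enorm s1 ^+ 2]; comparison with [x0] bounds [r k] times that excess
   by [enorm s2 ^+ 2]. *)
have s1bar_dist k : enorm (s1bar k - s1) ^+ 2 <= 2 * enorm s2 ^+ 2 * (r k)^-1.
  have := min1 _ (edom_midpoint f_convex Dx0 (Dxbar k)).
  rewrite residual_midpoint -s1x0 -s1barE => gap1.
  rewrite ler_pdivlMr//.
  have := opt k x0 Dx0; rewrite -s1x0 -s2E => opt0.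
  have := sqr_ge0 (enorm (s2bar k)).
  move: gap1 opt0; rewrite -subr_ge0 -(pmulr_rge0 _ (r_gt0 k)).
  move: (r k) (enorm (s1bar k) ^+ 2) (enorm (s2bar k) ^+ 2) => *.
  by lra.
have s1_cvg : s1bar @ \oo --> s1.
  apply: cvg_enorm_sq.
  apply: (@squeeze_cvgr _ _ _ _ (fun=> 0) (fun k => 2 * enorm s2 ^+ 2 * (r k)^-1)).
  - by near=> k; rewrite sqr_ge0 s1bar_dist.
  - exact: cvg_cst.
  - rewrite -[X in _ --> X](mulr0 (2 * enorm s2 ^+ 2)).
    apply: cvgMr; apply/(gtr0_cvgV0 (f := r)) => //.
    by near=> k.
split => //.
have s2bar_gap k l : (k <= l)%N -> enorm (s2bar l - s2bar k) ^+ 2 <=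
    2 * (enorm (s2bar l) ^+ 2 - enorm (s2bar k) ^+ 2).
  move=> /r_ndecr rkl.
  have := gap k _ (Dxbar l); rewrite -s1barE -s2barE.
  have := gap l _ (Dxbar k); rewrite -s1barE -s2barE.
  have enormB m (u v : 'cV[R]_m) : enorm (u - v) = enorm (v - u).
    rewrite /enorm; congr Num.sqrt; apply: eq_bigr => i _.
    by rewrite !mxE -sqrrN opprB.
  rewrite (enormB _ (s1bar k)) (enormB _ (s2bar k)).
  have := sqr_ge0 (enorm (s1bar l - s1bar k)).
  have := sqr_ge0 (enorm (s2bar l - s2bar k)).
  move: (enorm (s1bar l - s1bar k) ^+ 2) (enorm (s2bar l - s2bar k) ^+ 2)
    (@enorm_sq_le0_eq _ _ (s2bar l) (s2bar k)) => d1 d2 d20.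
  have := r_gt0 k.
  move: (enorm (s1bar k) ^+ 2) (enorm (s1bar l) ^+ 2) => u1 v1.
  (* For equal ratios the right-hand sides of the two gaps cancel in the sum, so [d2] vanishes and
     the residuals coincide. *)
  have [<-|rkl'] := eqVneq (r k) (r l) => rk0 d2_ge0 d1_ge0 gapl gapk.
    have r1 : 0 <= r k * d1 by rewrite mulr_ge0// ltW.
    by rewrite d20 ?subrr; lra.
  have {}rkl : r k < r l by rewrite lt_neqAle rkl'.
  (* [r l * gapk + r k * gapl] eliminates the first-level norms [u1] and [v1]. *)
  have rl0 := r_gt0 l.
  rewrite -(ler_pM2l (x := r l - r k)) ?subr_gt0//.
  have := ler_wpM2l (ltW rk0) gapl; have := ler_wpM2l (ltW rl0) gapk.
  (* The combination carries [d2] with coefficient [r l + r k]; dropping twice these two nonnegative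
     terms leaves [r l - r k]. *)
  have rrd : 0 <= r k * (r l * d1) by do 2?[apply: mulr_ge0; rewrite ?(ltW rk0) ?(ltW rl0)].
  have rd : 0 <= r k * d2 by rewrite mulr_ge0// ltW.
  move: (r k) (r l) (enorm (s2bar k) ^+ 2) (enorm (s2bar l) ^+ 2) rrd rd.
  by move=> *; lra.
have /cvg_ex[/= p s2bar_p] : cvgn s2bar.
  apply: (is_cvg_enorm_sq_gap _ s2bar_gap).
  apply: nondecreasing_is_cvgn.
    move=> k l kl; have := s2bar_gap _ _ kl.
    have /le_trans/[apply] := sqr_ge0 (enorm (s2bar l - s2bar k)).
    by rewrite pmulr_rge0 // subr_ge0.
  by exists (enorm s2 ^+ 2) => _ [k _ <-].
(* Closedness of the stacked image yields a single [y] attaining both limits at once. *)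
have [y Dy Ay] : ((fun x => col_mx A1 A2 *m x) @` edom f)
    (col_mx (b1 - s1) (b2 - p)).
  apply: (closed_cvg _ A_dom_closed _ _
    (cvg_col_mx (u := fun k => b1 - s1bar k) (v := fun k => b2 - s2bar k)
      (cvgB (cvg_cst b1) s1_cvg) (cvgB (cvg_cst b2) s2bar_p))).
  apply: nearW => k; exists (xbar k) => //.
  by rewrite mul_col_mx s1barE s2barE !subKr.
move: Ay; rewrite mul_col_mx => /eq_col_mx[A1y A2y].
have s1y : s1 = b1 - A1 *m y by rewrite A1y subKr.
have pE : p = b2 - A2 *m y by rewrite A2y subKr.
have p_le : enorm p ^+ 2 <= enorm s2 ^+ 2.
  apply: (closed_cvg (fun t => t <= enorm s2 ^+ 2) (@closed_le _ _) _ _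
    (enorm_sq_cvg s2bar_p)).
  by apply: nearW => k; exact: s2bar_le.
suff <- : p = s2 by [].
apply: enorm_sq_le0_eq.
(* Since [A1 *m x0 = A1 *m y], the midpoint stays in the first-level set; its residual would be
   shorter than [s2] unless [p = s2], because [p] is no longer than [s2]. *)
have := min2 _ (edom_midpoint f_convex Dx0 Dy).
rewrite residual_midpoint -s2E -pE.
have -> : s1 = b1 - A1 *m (2^-1 *: (x0 + y)).
  have A1x0 : A1 *m x0 = A1 *m y by rewrite A1y s1x0 subKr.
  rewrite -scalemxAr mulmxDr A1x0 A1y scalerDr -scalerDl.
  have -> : 2^-1 + 2^-1 = 1 :> R by field.
  by rewrite scale1r subKr.
move=> /(_ erefl) gap2; lra.
Unshelve. all: by end_near.
Qed.
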